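(* Let $\Bbbk$ be a field and let $Q=(Q_0,Q_1,s,t)$ be a quiver, where $Q_0$ and $Q_1$ are allowed to be infinite. Then the associated path coalgebra $\Bbbk Q$ always admits bialgebra structures, i.e. there exist a multiplication and a unit on the vector space $\Bbbk Q$ which, together with the comultiplication and counit of the path coalgebra, make $\Bbbk Q$ a bialgebra over $\Bbbk$.
   Context: A quiver is a quadruple $Q=(Q_0,Q_1,s,t)$ where $Q_0$ is the set of vertices, $Q_1$ the set of arrows, and $s,t:Q_1\to Q_0$ assign to each arrow its source and target. Vertices are regarded as trivial paths of length $0$, with $s(g)=g=t(g)$ for $g\in Q_0$. A nontrivial path of length $n\ge 1$ is $p=a_n\cdots a_1$ with $a_i\in Q_1$ and $s(a_{i+1})=t(a_i)$ for $i=1,\dots,n-1$. The path coalgebra $\Bbbk Q$ is the $\Bbbk$-vector space with basis all paths of $Q$, with comultiplication $\Delta$ and counit $\varepsilon$ given by $\Delta(g)=g\otimes g$, $\varepsilon(g)=1$ for $g\in Q_0$, and for a nontrivial path $p=a_n\cdots a_1$, $$\Delta(p)=t(a_n)\otimes p+\sum_{i=1}^{n-1}a_n\cdots a_{i+1}\otimes a_i\cdots a_1+p\otimes s(a_1),\qquad \varepsilon(p)=0.$$ All tensor products are over $\Bbbk$; bialgebras are associative and unital, coassociative and counital, but need not have an antipode.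
   Formalization: The quiver is assumed to have at least one vertex: for the empty quiver the path coalgebra is 0, which has no bialgebra structure since the counit would have to send 1 = 0 to 1. *)

(* Defs.v *)
From HB Require Import structures.
From mathcomp Require Import all_boot all_algebra.
From mathcomp Require Import finmap boolp.
From mathcomp Require Import monalg.

Set Implicit Arguments.
Unset Strict Implicit.
Unset Printing Implicit Defensive.

Import GRing.Theory.
Local Open Scope ring_scope.

(* [{malg k[K]}] is the k-vector space with basis K, with basis vectors
   [<< p >>].  The tensor product of [{malg k[K]}] and [{malg k[L]}] is taken to
   be [{malg k[K * L]}], with [tens x y] in the role of the pure tensor of x and
   y; [tens_bilinear], [tens_liftE] and [tens_lift_unique] are its universal
   property. *)

Section LinearExtension.
Context {k : fieldType} {K : choiceType} {V : lmodType k}.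

Definition lin_ext (f : K -> V) (x : {malg k[K]}) : V :=
  \sum_(p <- msupp x) x@_p *: f p.

Lemma lin_extEw (f : K -> V) (d : {fset K}) (x : {malg k[K]}) :
  (msupp x `<=` d)%fset -> lin_ext f x = \sum_(p <- d) x@_p *: f p.
Proof.
move=> le_d; rewrite /lin_ext (big_fset_incl _ le_d) //= => p _ /mcoeff_outdom ->.
by rewrite scale0r.
Qed.

Lemma lin_ext_is_linear (f : K -> V) : linear (lin_ext f).
Proof.
move=> c x y; pose d := (msupp (c *: x + y) `|` (msupp x `|` msupp y))%fset.
rewrite !(@lin_extEw f d) /d ?fsubsetUl ?fsubsetUr //; last first.
- by rewrite fsetUCA fsubsetUl.
- by rewrite fsetUA fsubsetUr.
rewrite scaler_sumr -big_split; apply: eq_bigr => p _ /=.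
by rewrite mcoeffD mcoeffZ scalerDl scalerA.
Qed.

HB.instance Definition _ (f : K -> V) :=
  GRing.isLinear.Build k {malg k[K]} V *:%R (lin_ext f) (lin_ext_is_linear f).

Lemma lin_extU (f : K -> V) (p : K) : lin_ext f << p >> = f p.
Proof. by rewrite /lin_ext msuppU oner_eq0 big_seq_fset1 mcoeffUU scale1r. Qed.

Lemma malg_lin_ext (x : {malg k[K]}) : x = \sum_(p <- msupp x) x@_p *: << p >>.
Proof.
rewrite {1}[x]monalgE; apply: eq_bigr => p _; apply/malgP => q.
by rewrite mcoeffZ !mcoeffU mulrnAr mulr1.
Qed.

Lemma lin_ext_unique (g h : {malg k[K]} -> V) :
  linear g -> linear h -> (forall p, g << p >> = h << p >>) -> g =1 h.
Proof.
move=> lin_g lin_h eq_gh x.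
pose G : {linear _ -> _} := HB.pack g (GRing.isLinear.Build _ _ _ _ g lin_g).
pose H : {linear _ -> _} := HB.pack h (GRing.isLinear.Build _ _ _ _ h lin_h).
rewrite -[g x]/(G x) -[h x]/(H x) [x]malg_lin_ext !linear_sum.
by apply: eq_bigr => p _; rewrite !linearZ /=; congr (_ *: _); apply: eq_gh.
Qed.

End LinearExtension.

Notation bilinear_map f := (bilinear_for *:%R *:%R f).

Definition basis_prod (K L : choiceType) : choiceType := Choice.clone (K * L)%type _.

Section Tensor.
Context {k : fieldType} {K L : choiceType}.

Definition tens (x : {malg k[K]}) (y : {malg k[L]}) : {malg k[basis_prod K L]} :=
  lin_ext (fun p => lin_ext (fun q => << (p, q) >>) y) x.

Definition tens_lift {W : lmodType k} (f : {malg k[K]} -> {malg k[L]} -> W) :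
    {malg k[basis_prod K L]} -> W :=
  lin_ext (fun pq => f << pq.1 >> << pq.2 >>).

Lemma tensU (p : K) (q : L) : tens << p >> << q >> = << (p, q) >>.
Proof. by rewrite /tens !lin_extU. Qed.

Lemma tens_bilinear : bilinear_map tens.
Proof.
split=> [y|x] c u v /=; first by rewrite /tens linearP.
have tensE z : tens x z =
    \sum_(p <- msupp x) x@_p *: lin_ext (fun q => << (p, q) >>) z by [].
rewrite !tensE scaler_sumr -big_split; apply: eq_bigr => p _ /=.
by rewrite linearP /= scalerDr !scalerA mulrC.
Qed.

Lemma tens_lift_linear {W : lmodType k} (f : {malg k[K]} -> {malg k[L]} -> W) :
  linear (tens_lift f).
Proof. exact: lin_ext_is_linear. Qed.

Lemma tens_liftE {W : lmodType k} (f : {malg k[K]} -> {malg k[L]} -> W) :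
  bilinear_map f -> forall x y, tens_lift f (tens x y) = f x y.
Proof.
move=> [fl fr] x y.
have [tl tr] := tens_bilinear.
move: x; apply: lin_ext_unique => [c u v|c u v|p] /=.
- by have -> := tl y c u v; rewrite tens_lift_linear.
- exact: fl.
move: y; apply: lin_ext_unique => [c u v|c u v|q] /=.
- by have -> := tr << p >> c u v; rewrite tens_lift_linear.
- exact: fr.
by rewrite tensU /tens_lift lin_extU.
Qed.

Lemma tens_lift_unique {W : lmodType k} (f : {malg k[K]} -> {malg k[L]} -> W)
    (g : {malg k[basis_prod K L]} -> W) :
  linear g -> (forall x y, g (tens x y) = f x y) -> g =1 tens_lift f.
Proof.
move=> lin_g gE; apply: lin_ext_unique => // [|[p q]].
  exact: tens_lift_linear.
by rewrite -tensU gE tensU /tens_lift lin_extU.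
Qed.

End Tensor.

Section TensorMaps.
Context {k : fieldType}.

Definition tens_map {K K' L L' : choiceType}
    (f : {malg k[K]} -> {malg k[K']}) (g : {malg k[L]} -> {malg k[L']}) :
    {malg k[basis_prod K L]} -> {malg k[basis_prod K' L']} :=
  tens_lift (fun x y => tens (f x) (g y)).

Definition tens_assoc {K L M : choiceType} :
    {malg k[basis_prod (basis_prod K L) M]} -> {malg k[basis_prod K (basis_prod L M)]} :=
  tens_lift (fun u z => tens_lift (fun x y => tens x (tens y z)) u).

(* The product on the tensor square of an algebra:
   (x (x) y) (x' (x) y') = (x x') (x) (y y'). *)
Definition tens_mul {K : choiceType}
    (mul : {malg k[K]} -> {malg k[K]} -> {malg k[K]}) (u v : {malg k[basis_prod K K]}) :
    {malg k[basis_prod K K]} :=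
  tens_lift (fun x y =>
    tens_lift (fun x' y' => tens (mul x x') (mul y y')) v) u.

End TensorMaps.

Section Bialgebra.
Context {k : fieldType} {K : choiceType}.
Local Notation A := {malg k[K]}.

Record is_coalgebra (comul : A -> {malg k[basis_prod K K]}) (counit : A -> k) : Prop := {
  comul_linear : linear comul;
  counit_scalar : scalar counit;
  comul_coassoc : forall x : A,
    tens_assoc (tens_map comul id (comul x)) = tens_map id comul (comul x);
  comul_counitl : forall x : A,
    tens_lift (fun y z : A => counit y *: z) (comul x) = x;
  comul_counitr : forall x : A,
    tens_lift (fun y z : A => counit z *: y) (comul x) = x
}.

Record is_algebra (mul : A -> A -> A) (one : A) : Prop := {
  mul_bilinear : bilinear_map mul;
  mul_assoc : associative mul;
  mul_onel : left_id one mul;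
  mul_oner : right_id one mul
}.

Record is_bialgebra (mul : A -> A -> A) (one : A)
    (comul : A -> {malg k[basis_prod K K]}) (counit : A -> k) : Prop := {
  bialgebra_algebra : is_algebra mul one;
  bialgebra_coalgebra : is_coalgebra comul counit;
  comul_mul : forall x y : A, comul (mul x y) = tens_mul mul (comul x) (comul y);
  comul_one : comul one = tens one one;
  counit_mul : forall x y : A, counit (mul x y) = counit x * counit y;
  counit_one : counit one = 1
}.

End Bialgebra.

Record quiver := Quiver {
  vertex : Type;
  arrow : Type;
  source : arrow -> vertex;
  target : arrow -> vertex
}.

Section Paths.
Context {Q : quiver}.

Fixpoint composable (g : vertex Q) (s : seq (arrow Q)) : Prop :=
  if s is a :: s' then source a = g /\ composable (target a) s' else True.

Definition walk_end (g : vertex Q) (s : seq (arrow Q)) : vertex Q :=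
  last g (map (@target Q) s).

Lemma composable_cat (g : vertex Q) (s1 s2 : seq (arrow Q)) :
  composable g (s1 ++ s2) <->
  composable g s1 /\ composable (walk_end g s1) s2.
Proof.
elim: s1 g => [|a s1 IH] g /=; first by split=> [|[]].
by rewrite IH; split=> [[? []]|[[]]].
Qed.

End Paths.

(* The path a_n ... a_1 is stored as its source s(a_1) together with the
   sequence [:: a_1; ...; a_n], in order of traversal; the trivial path at g has
   source g and no arrows. *)
Record qpath (Q : quiver) := QPath {
  psource : vertex Q;
  parrows : seq (arrow Q);
  parrowsP : composable psource parrows
}.

Section PathOperations.
Context {Q : quiver}.
Implicit Types (g : vertex Q) (p : qpath Q).

Definition ptarget p : vertex Q := walk_end (psource p) (parrows p).

Definition trivial_path g : qpath Q := @QPath Q g [::] I.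

Lemma composable_take_drop p (i : nat) :
  composable (psource p) (take i (parrows p)) /\
  composable (walk_end (psource p) (take i (parrows p))) (drop i (parrows p)).
Proof.
by apply/composable_cat; rewrite cat_take_drop; apply: parrowsP.
Qed.

(* For p = a_n ... a_1 and i <= n, these are a_i ... a_1 and a_n ... a_(i+1). *)
Definition ptake (i : nat) p : qpath Q :=
  QPath (proj1 (composable_take_drop p i)).
Definition pdrop (i : nat) p : qpath Q :=
  QPath (proj2 (composable_take_drop p i)).

Lemma qpath_eq (p q : qpath Q) :
  psource p = psource q -> parrows p = parrows q -> p = q.
Proof.
case: p q => [g s gs] [h t ht] /= gh st; case: _ / gh ht => ht.
by case: _ / st ht => ht; rewrite (Prop_irrelevance gs ht).
Qed.

End PathOperations.

Section PathCoalgebra.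
Context (k : fieldType) (Q : quiver).

(* [vertex Q] and [arrow Q] are arbitrary types, hence the classical
   choiceType structure on paths, which [malg] needs. *)
Definition path_index : choiceType := {classic qpath Q}.

Definition path_comul_basis (p : path_index) : {malg k[basis_prod path_index path_index]} :=
  let v (q : qpath Q) : {malg k[path_index]} := << (q : path_index) >> in
  let n := size (parrows p) in
  if n == 0%N then tens (v p) (v p)
  else tens (v (trivial_path (ptarget p))) (v p)
       + \sum_(1 <= i < n) tens (v (pdrop i p)) (v (ptake i p))
       + tens (v p) (v (trivial_path (psource p))).

Definition path_counit_basis (p : path_index) : k :=
  if size (parrows p) == 0%N then 1 else 0.

Definition path_comul : {malg k[path_index]} -> {malg k[basis_prod path_index path_index]} :=
  lin_ext path_comul_basis.

Definition path_counit : {malg k[path_index]} -> k :=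
  @lin_ext k path_index k^o path_counit_basis.

Lemma path_comul_basisE (p : path_index) :
  path_comul_basis p =
  \sum_(i < (size (parrows p)).+1)
     << ((pdrop i p, ptake i p) : basis_prod path_index path_index) >>.
Proof.
have take0p : ptake 0 p = trivial_path (psource p) by apply: qpath_eq; rewrite //= take0.
have drop0p : pdrop 0 p = p by apply: qpath_eq; rewrite /= ?take0 ?drop0.
have takenp : ptake (size (parrows p)) p = p.
  by apply: qpath_eq; rewrite //= take_size.
have dropnp : pdrop (size (parrows p)) p = trivial_path (ptarget p).
  by apply: qpath_eq; rewrite /= ?take_size ?drop_size.
rewrite /path_comul_basis; case: eqP => [p0|/eqP]; last rewrite -lt0n => n_gt0.
  rewrite p0 big_ord1 tensU drop0p take0p; congr << (_, _) >>.
  by apply: qpath_eq => //=; apply: size0nil.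
pose F i : {malg k[basis_prod path_index path_index]} :=
  << ((pdrop i p, ptake i p) : basis_prod path_index path_index) >>.
rewrite -(big_mkord xpredT F) big_nat_recr //= [in RHS]big_ltn // {1 3}/F.
rewrite take0p drop0p takenp dropnp !tensU [RHS]addrC addrA [RHS]addrAC.
by congr (_ + _ + _); apply: eq_bigr => i _; rewrite tensU.
Qed.
(* The zero coalgebra of the empty quiver carries no bialgebra structure. *)
Lemma bialgebra_inhabited (mul : _ -> _ -> _) (one : _) :
  is_bialgebra mul one path_comul path_counit -> inhabited (vertex Q).
Proof.
move=> H; apply: contrapT => Q0_empty.
have /eqP := counit_one H; rewrite /path_counit.
suff -> : one = 0 by rewrite linear0 eq_sym oner_eq0.
by apply/malgP => p; case: Q0_empty; split; exact: psource p.
Qed.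

End PathCoalgebra.

(* Main.v *)
(* Fix a vertex e, let e act as the identity on arrows from both sides and let
   every other vertex act as zero.  This makes the span of the arrows a Hopf
   bimodule over the monoid algebra of the vertices, and the induced product on
   paths is a shuffle product.

   Let d_a remove the first arrow of a path if it is a (and kill the path
   otherwise), let E project onto the paths starting at e and let t project onto
   the trivial paths.  Then d_a is a twisted derivation,
     d_a (x y) = d_a(x) E(y) + E(x) d_a(y),
   and E and t are multiplicative; moreover (id (x) d_a) Delta = Delta d_a and
   (id (x) E) Delta = Delta E.  An element is determined by its images under t
   and all the d_a, and a tensor by its images under id (x) t and all the
   id (x) d_a.  Since the d_a shorten paths, each bialgebra identity follows by
   induction on the total length of the paths involved. *)

Require Import Defs.
From HB Require Import structures.
From mathcomp Require Import all_boot all_algebra.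
From mathcomp Require Import boolp.
From mathcomp Require Import monalg.

Set Implicit Arguments.
Unset Strict Implicit.
Unset Printing Implicit Defensive.

Import GRing.Theory.
Local Open Scope ring_scope.

(** * Linear and multilinear maps on free modules and their tensor products *)

Section LinearMaps.
Context {k : fieldType} {K L : choiceType}.

(** Needed because [tens_mul] contains its second argument only inside the values of the outer
    lift. *)
Lemma lin_ext_linear_values {V : lmodType k} (c : k) (f g h : K -> V) x :
    (forall p, h p = c *: f p + g p) ->
  lin_ext h x = c *: lin_ext f x + lin_ext g x.
Proof.
move=> hE; rewrite /lin_ext scaler_sumr -big_split; apply: eq_bigr => p _ /=.
by rewrite hE scalerDr !scalerA mulrC.
Qed.

HB.instance Definition _ :=
  bilinear_isBilinear.Build k _ _ _ _ _ (@tens k K L) tens_bilinear.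

HB.instance Definition _ (W : lmodType k) (f : {malg k[K]} -> {malg k[L]} -> W) :=
  GRing.isLinear.Build k _ _ _ (tens_lift f) (tens_lift_linear f).

Lemma tens_liftU {W : lmodType k} (f : {malg k[K]} -> {malg k[L]} -> W) p q :
  tens_lift f << (p, q) >> = f << p >> << q >>.
Proof. by rewrite /tens_lift lin_extU. Qed.

Lemma bilinear_ext {W : lmodType k} (f g : {malg k[K]} -> {malg k[L]} -> W) :
    bilinear_map f -> bilinear_map g ->
    (forall p q, f << p >> << q >> = g << p >> << q >>) ->
  forall x y, f x y = g x y.
Proof.
move=> f2 g2 fg x y; rewrite -(tens_liftE f2) -(tens_liftE g2).
apply: lin_ext_unique => [||[p q]]; try exact: tens_lift_linear.
by rewrite !tens_liftU.
Qed.

End LinearMaps.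

Lemma trilinear_ext {k : fieldType} {K L M : choiceType} {W : lmodType k}
    (f g : {malg k[K]} -> {malg k[L]} -> {malg k[M]} -> W) :
    (forall y z, linear (f^~ y ^~ z)) -> (forall x z, linear (f x ^~ z)) ->
    (forall x y, linear (f x y)) ->
    (forall y z, linear (g^~ y ^~ z)) -> (forall x z, linear (g x ^~ z)) ->
    (forall x y, linear (g x y)) ->
    (forall p q r, f << p >> << q >> << r >> = g << p >> << q >> << r >>) ->
  forall x y z, f x y z = g x y z.
Proof.
move=> f1 f2 f3 g1 g2 g3 fg x y z; move: z; apply: lin_ext_unique => // r.
by move: x y; apply: bilinear_ext.
Qed.

Section TensorMaps.
Context {k : fieldType} {K K' L L' M : choiceType}.

HB.instance Definition _ f g := GRing.Linear.on (@tens_map k K K' L L' f g).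

HB.instance Definition _ := GRing.Linear.on (@tens_assoc k K L M).

Lemma tens_mapE (f : {linear {malg k[K]} -> {malg k[K']}})
    (g : {linear {malg k[L]} -> {malg k[L']}}) x y :
  tens_map f g (tens x y) = tens (f x) (g y).
Proof.
rewrite /tens_map tens_liftE //.
split=> z c u v; rewrite linearP /=; [exact: tens_bilinear.1|exact: tens_bilinear.2].
Qed.

Lemma tens_mapU (f : {malg k[K]} -> {malg k[K']}) (g : {malg k[L]} -> {malg k[L']}) p q :
  tens_map f g << (p, q) >> = tens (f << p >>) (g << q >>).
Proof. exact: tens_liftU. Qed.

Lemma tens_assocU (p : K) (q : L) (r : M) :
  tens_assoc << ((p, q), r) >> = << (p, (q, r)) >> :> {malg k[_]}.
Proof. by rewrite /tens_assoc !tens_liftU !tensU. Qed.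

End TensorMaps.

Section BilinearCombinators.
Context {k : fieldType} {U U' V V' W W' : lmodType k}.
Implicit Types (B : U -> V -> W).

Lemma bilinear_add B B' : bilinear_map B -> bilinear_map B' ->
  bilinear_map (fun u v => B u v + B' u v).
Proof.
move=> B2 B'2; split=> z c u v /=.
  by rewrite B2.1 B'2.1 scalerDr addrACA.
by rewrite B2.2 B'2.2 scalerDr addrACA.
Qed.

Lemma bilinear_comp B (f : U' -> U) (g : V' -> V) :
    bilinear_map B -> linear f -> linear g ->
  bilinear_map (fun u v => B (f u) (g v)).
Proof. by move=> B2 lin_f lin_g; split=> z c u v /=; rewrite ?lin_f ?lin_g (B2.1, B2.2). Qed.

Lemma linear_comp_bilinear B (h : W -> W') : linear h -> bilinear_map B ->
  bilinear_map (fun u v => h (B u v)).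
Proof. by move=> lin_h B2; split=> z c u v /=; rewrite (B2.1, B2.2) lin_h. Qed.

End BilinearCombinators.

Section TensorProductAlgebra.
Context {k : fieldType} {K : choiceType} {mul : {malg k[K]} -> {malg k[K]} -> {malg k[K]}}.
Hypothesis mul_bilin : bilinear_map mul.

Lemma tens_mul_bilinear : bilinear_map (tens_mul mul).
Proof.
split=> [v|u] c w z; first exact: tens_lift_linear.
by apply: lin_ext_linear_values => p; apply: tens_lift_linear.
Qed.

HB.instance Definition _ :=
  bilinear_isBilinear.Build k _ _ _ _ _ (tens_mul mul) tens_mul_bilinear.

Lemma tens_mulE x x' y y' :
  tens_mul mul (tens x x') (tens y y') = tens (mul x y) (mul x' y').
Proof.
rewrite /tens_mul !tens_liftE //; split=> z c u v.
- by rewrite /= mul_bilin.2; apply: tens_bilinear.1.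
- by rewrite /= mul_bilin.2; apply: tens_bilinear.2.
- by apply: lin_ext_linear_values => p; rewrite /= mul_bilin.1; apply: tens_bilinear.1.
- by apply: lin_ext_linear_values => p; rewrite /= mul_bilin.1; apply: tens_bilinear.2.
Qed.

Lemma tens_map_id_mulE (f : {linear {malg k[K]} -> {malg k[K]}}) x x' y y' :
  tens_map id f (tens_mul mul (tens x x') (tens y y')) = tens (mul x y) (f (mul x' y')).
Proof. exact: etrans (congr1 _ (tens_mulE _ _ _ _)) (tens_mapE idfun f _ _). Qed.

Lemma tens_mul_map_idE (f g : {linear {malg k[K]} -> {malg k[K]}}) x x' y y' :
  tens_mul mul (tens_map id f (tens x x')) (tens_map id g (tens y y')) =
  tens (mul x y) (mul (f x') (g y')).
Proof.
exact: etrans (f_equal2 _ (tens_mapE idfun f _ _) (tens_mapE idfun g _ _)) (tens_mulE _ _ _ _).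
Qed.

End TensorProductAlgebra.

(** * Linear maps induced by partial maps between bases *)

Section PartialMaps.
Context {k : fieldType}.

(** The common shape of [start_at], [trivial_part], [strip] and [prepend], each of which sends a
    path to a path or to zero. *)
Definition lin_pmap {K K' : choiceType} (h : K -> option K') : {malg k[K]} -> {malg k[K']} :=
  lin_ext (fun p => oapp (fun q => << q >>) 0 (h p)).

HB.instance Definition _ (K K' : choiceType) (h : K -> option K') :=
  GRing.Linear.on (lin_pmap h).

Lemma lin_pmapU (K K' : choiceType) (h : K -> option K') p :
  lin_pmap h << p >> = oapp (fun q => << q >>) 0 (h p).
Proof. exact: lin_extU. Qed.

(** No basis vector other than [r] contributes to the coefficient at [s]. *)
Lemma mcoeff_lin_pmap (K K' : choiceType) (h : K -> option K') r s :
    (forall p, h p = Some s -> p = r) -> h r = Some s ->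
  forall x, (lin_pmap h x)@_s = x@_r.
Proof.
move=> h_inj hr.
apply: (@lin_ext_unique k K k^o) => [c u v|c u v|p].
- by rewrite linearP mcoeffD mcoeffZ.
- by rewrite mcoeffD mcoeffZ.
rewrite lin_pmapU mcoeffU; case: eqP => [->|neq_pr]; first by rewrite hr mcoeffUU.
case hp: (h p) => [q|] /=; rewrite ?mcoeff0 // mcoeffU; case: eqP => // qs.
by case: neq_pr; apply: h_inj; rewrite hp qs.
Qed.

Lemma tens_map_lin_pmap (K L L' : choiceType) (h : L -> option L') :
  tens_map id (lin_pmap h) =1
  lin_pmap (fun pq : basis_prod K L =>
              omap (fun q => (pq.1, q) : basis_prod K L') (h pq.2)).
Proof.
apply: lin_ext_unique => [||[p q]]; try exact: lin_ext_is_linear.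
rewrite /tens_map tens_liftU !lin_pmapU /=; case: (h q) => [r|] /=.
  exact: tensU.
by rewrite linear0r.
Qed.

End PartialMaps.

(** * Operators on paths: selection by source or length, removal and addition of a first arrow *)

Section Operators.
Context {k : fieldType} {Q : quiver}.
Notation A := {malg k[path_index Q]}.
Notation AA := {malg k[basis_prod (path_index Q) (path_index Q)]}.
Implicit Types (g : vertex Q) (a : arrow Q) (p q r : path_index Q) (x y z : A).

Definition plength p : nat := size (parrows p).
Definition phead p : option (arrow Q) := ohead (parrows p).

Definition ptail p : path_index Q := pdrop 1 p.

(** Since [a] is traversed before [p], the result is the path written $p\,a$. *)
Definition pcons a p : option (path_index Q) :=
  if pselect (psource p = target a) is left pE
  then Some (@QPath Q (source a) (a :: parrows p)
         (conj erefl (eq_ind _ (fun g => composable g (parrows p)) (parrowsP p) _ pE)))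
  else None.

Definition start_at g : A -> A :=
  lin_pmap (fun p => if `[< psource p = g >] then Some p else None).
Definition trivial_part : A -> A :=
  lin_pmap (fun p => if plength p == 0%N then Some p else None).
Definition strip a : A -> A :=
  lin_pmap (fun p => if `[< phead p = Some a >] then Some (ptail p) else None).
Definition prepend a : A -> A := lin_pmap (pcons a).

HB.instance Definition _ g := GRing.Linear.on (start_at g).
HB.instance Definition _ := GRing.Linear.on trivial_part.
HB.instance Definition _ a := GRing.Linear.on (strip a).
HB.instance Definition _ a := GRing.Linear.on (prepend a).

Lemma start_atU g p : start_at g << p >> = if `[< psource p = g >] then << p >> else 0.
Proof. by rewrite /start_at lin_pmapU; case: ifP. Qed.

Lemma trivial_partU p : trivial_part << p >> = if plength p == 0%N then << p >> else 0.
Proof. by rewrite /trivial_part lin_pmapU; case: ifP. Qed.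

Lemma stripU a p :
  strip a << p >> = if `[< phead p = Some a >] then << ptail p >> else 0.
Proof. by rewrite /strip lin_pmapU; case: ifP. Qed.

Lemma phead_source p a : phead p = Some a -> psource p = source a.
Proof. by case: p => g [|b s] // [/= bg cs] [<-]. Qed.

Lemma psource_ptail p a : phead p = Some a -> psource (ptail p) = target a.
Proof. by case: p => g [|b s] //= ? [->]; rewrite /walk_end /= take0. Qed.

Lemma plength_ptail p a : phead p = Some a -> plength p = (plength (ptail p)).+1.
Proof. by case: p => g [|b s] //= ? _; rewrite /plength /= drop0. Qed.

Lemma plength_eq0_phead p : (plength p == 0%N) = (phead p == None :> option {classic arrow Q}).
Proof. by case: p => g []. Qed.

(** The first arrow [a] restores what [ptail] forgets: the source of the path and the arrow
    itself. *)
Lemma ptail_inj a p q : phead p = Some a -> phead q = Some a ->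
  ptail p = ptail q -> p = q.
Proof.
move=> pa qa pq; apply: qpath_eq; first by rewrite (phead_source pa) (phead_source qa).
move: pa qa (congr1 (@parrows Q) pq); rewrite /phead /=.
by case: (parrows p) (parrows q) => [|b s] [|c t] //= [->] [->]; rewrite !drop0 => ->.
Qed.

Lemma strip_coef a r x : phead r = Some a -> (strip a x)@_(ptail r) = x@_r.
Proof.
move=> ra; apply: mcoeff_lin_pmap; last by rewrite asboolT.
by move=> p; case: asboolP => // pa /Some_inj/(ptail_inj pa ra).
Qed.

(** A path is either trivial or has a first arrow [a], so its coefficient can be seen in
    [trivial_part] or in [strip a]. *)
Lemma strip_ext x y :
    (forall a, strip a x = strip a y) -> trivial_part x = trivial_part y -> x = y.
Proof.
move=> xy xy0; apply/malgP => r; case ra: (phead r) => [a|].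
  by rewrite -(strip_coef x ra) xy strip_coef.
have r0 : plength r == 0%N by rewrite plength_eq0_phead ra.
have coef0 z : (trivial_part z)@_r = z@_r.
  by apply: mcoeff_lin_pmap => [p|]; rewrite ?r0 //; case: ifP => // _ /Some_inj.
by rewrite -(coef0 x) xy0 coef0.
Qed.

(** The same dichotomy, for the second component [r] of a basis pair; the first component [q] is
    carried along unchanged. *)
Lemma strip_ext_tens (u v : AA) :
    (forall a, tens_map id (strip a) u = tens_map id (strip a) v) ->
    tens_map id trivial_part u = tens_map id trivial_part v -> u = v.
Proof.
move=> uv uv0; apply/malgP => -[q r]; case ra: (phead r) => [a|].
  have coef w : (tens_map id (strip a) w)@_((q, ptail r) : basis_prod _ _) = w@_(q, r).
    rewrite tens_map_lin_pmap; apply: mcoeff_lin_pmap => /= [[q' p] /=|].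
      by case: asboolP => // pa /Some_inj/pair_equal_spec[-> /(ptail_inj pa ra)->].
    by rewrite asboolT.
  by rewrite -(coef u) uv coef.
have r0 : plength r == 0%N by rewrite plength_eq0_phead ra.
have coef0 w : (tens_map id trivial_part w)@_((q, r) : basis_prod _ _) = w@_(q, r).
  rewrite tens_map_lin_pmap; apply: mcoeff_lin_pmap => /= [[q' p] /=|]; last by rewrite r0.
  by case: ifP => // _ /Some_inj.
by rewrite -(coef0 u) uv0 coef0.
Qed.

Lemma start_at_prepend g a x :
  start_at g (prepend a x) = if `[< source a = g >] then prepend a x else 0.
Proof.
move: x; apply: lin_ext_unique => [c u v|c u v|p]; first by rewrite !linearP.
  by case: ifP => _; rewrite ?linearP // scaler0 addr0.
rewrite /prepend lin_pmapU /pcons; case: pselect => [pE|] /=; last by rewrite linear0 if_same.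
by rewrite start_atU.
Qed.

Lemma trivial_part_prepend a x : trivial_part (prepend a x) = 0.
Proof.
move: x; apply: (lin_ext_unique (h := fun=> 0)) => [c u v|c u v|p]; first by rewrite !linearP.
  by rewrite scaler0 addr0.
rewrite /prepend lin_pmapU /pcons; case: pselect => [pE|] /=; last by rewrite linear0.
by rewrite trivial_partU.
Qed.

(** A projection remains instead of the identity, because [prepend b] kills the paths that do not
    start at the target of [b]. *)
Lemma strip_prepend a b x :
  strip a (prepend b x) = if `[< b = a >] then start_at (target a) x else 0.
Proof.
move: x; apply: lin_ext_unique => [c u v|c u v|p]; first by rewrite !linearP.
  by case: ifP => _; rewrite ?linearP // scaler0 addr0.
rewrite /prepend lin_pmapU /pcons start_atU; case: asboolP => [<-|neq_ba]; last first.
  case: pselect => [pE|] /=; rewrite ?linear0 // stripU asboolF //.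
  by rewrite /phead /= => -[].
case: pselect => [pE|ntp] /=; last by rewrite linear0 asboolF.
rewrite stripU !asboolT //; congr << _ >>; apply: qpath_eq => /=; last by rewrite drop0.
by rewrite /walk_end /= take0 pE.
Qed.

End Operators.

(** * The coalgebra axioms *)

Section PathCoalgebraAxioms.
Context {k : fieldType} {Q : quiver}.
Notation A := {malg k[path_index Q]}.
Notation comul := (@path_comul k Q).
Notation counit := (@path_counit k Q).
Implicit Types (g : vertex Q) (a : arrow Q) (p q r : path_index Q) (x y z : A).

HB.instance Definition _ := GRing.Linear.on comul.

Lemma path_counit_scalar : scalar counit.
Proof. exact: (@lin_ext_is_linear k _ k^o). Qed.

HB.instance Definition _ := GRing.isLinear.Build k A k *%R counit path_counit_scalar.

Lemma path_comulU p : comul << p >> =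
  \sum_(i < (plength p).+1) << ((pdrop i p, ptake i p) : basis_prod (path_index Q) (path_index Q)) >>.
Proof. by rewrite /path_comul lin_extU path_comul_basisE. Qed.

Lemma path_counitU p : counit << p >> = (plength p == 0%N)%:R.
Proof. by rewrite /path_counit lin_extU /path_counit_basis; case: ifP. Qed.

Lemma plength_ptake i p : (i <= plength p)%N -> plength (ptake i p) = i.
Proof. exact: size_takel. Qed.

Lemma plength_pdrop i p : plength (pdrop i p) = (plength p - i)%N.
Proof. exact: size_drop. Qed.

Lemma pdrop0 p : pdrop 0 p = p.
Proof. by apply: qpath_eq; rewrite /= ?take0 ?drop0. Qed.

Lemma ptake_plength p : ptake (plength p) p = p.
Proof. by apply: qpath_eq; rewrite //= take_size. Qed.

Lemma ptake0 p : ptake 0 p = trivial_path (psource p).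
Proof. by apply: qpath_eq; rewrite //= take0. Qed.

Lemma pdrop_pdrop i j p : pdrop i (pdrop j p) = pdrop (i + j) p.
Proof.
by apply: qpath_eq; rewrite /= ?drop_drop //= addnC takeD /walk_end map_cat last_cat.
Qed.

Lemma ptake_ptake i j p : (i <= j)%N -> ptake i (ptake j p) = ptake i p.
Proof. by move=> ij; apply: qpath_eq; rewrite //= take_takel. Qed.

Lemma ptake_pdrop i j p : ptake i (pdrop j p) = pdrop j (ptake (i + j) p).
Proof.
apply: qpath_eq => /=; first by rewrite take_takel // leq_addl.
by rewrite take_drop.
Qed.

Lemma phead_ptake i p : phead (ptake i.+1 p) = phead p.
Proof. by rewrite /phead /=; case: (parrows p). Qed.

(** Right factors of $\Delta(p)$ are initial segments of [p], so removing their first arrow turns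
    the cut of [p] after $i+1$ arrows into the cut of [ptail p] after $i$; the cut after $0$ arrows
    vanishes. *)
Lemma strip_comul a x : tens_map id (strip a) (comul x) = comul (strip a x).
Proof.
move: x; apply: lin_ext_unique => [c u v|c u v|p]; rewrite ?linearP //.
rewrite path_comulU linear_sum big_ord_recl /= tens_mapU stripU ptake0.
rewrite asboolF // linear0r add0r stripU; case: asboolP => [pa|npa]; last first.
  by rewrite linear0 big1 // => i _; rewrite tens_mapU stripU phead_ptake asboolF ?linear0r.
rewrite path_comulU (plength_ptail pa); apply: eq_bigr => i _.
rewrite tens_mapU stripU phead_ptake asboolT // tensU /ptail pdrop_pdrop ptake_pdrop.
by rewrite addn1.
Qed.

Lemma start_at_comul g x : tens_map id (start_at g) (comul x) = comul (start_at g x).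
Proof.
move: x; apply: lin_ext_unique => [c u v|c u v|p]; rewrite ?linearP //.
rewrite path_comulU linear_sum start_atU /=.
case: asboolP => pg; last first.
  by rewrite linear0 big1 // => i _; rewrite tens_mapU start_atU asboolF ?linear0r.
rewrite path_comulU; apply: eq_bigr => i _.
by rewrite tens_mapU start_atU asboolT // tensU.
Qed.

(** Only the cut after $0$ arrows has a trivial right factor, namely the source; fixing the source
    as [g] makes the right-hand side linear in [x]. *)
Lemma trivial_part_comul_start_at g x :
  tens_map id trivial_part (comul (start_at g x)) =
  tens (start_at g x) << (trivial_path g : path_index Q) >>.
Proof.
move: x; apply: lin_ext_unique => [c u v|c u v|p].
- by rewrite !linearP.
- by rewrite linearP; apply: tens_bilinear.1.
rewrite start_atU; case: asboolP => [<-|_]; last by rewrite linear0l !linear0.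
rewrite path_comulU linear_sum big_ord_recl /= tens_mapU trivial_partU ptake0 pdrop0 /=.
by rewrite big1 ?addr0 // => i _; rewrite tens_mapU trivial_partU plength_ptake ?linear0r.
Qed.

(** Both sides list the factorisations of a path into three consecutive pieces, given by two cuts
    $i\le j$. *)
Lemma path_coassoc x :
  tens_assoc (tens_map comul id (comul x)) = tens_map id comul (comul x).
Proof.
move: x; apply: lin_ext_unique => [c u v|c u v|p]; rewrite ?linearP //.
rewrite path_comulU (linear_sum (tens_map comul id)) (linear_sum tens_assoc).
rewrite [in RHS]linear_sum /=; set n := plength p.
pose F i j : {malg k[_]} := << ((pdrop j p, (ptake (j - i) (pdrop i p), ptake i p)) :
   basis_prod (path_index Q) (basis_prod (path_index Q) (path_index Q))) >>.
transitivity (\sum_(i < n.+1) \sum_(j < n.+1 | (i <= j)%N) F i j).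
  apply: eq_bigr => i _.
  transitivity (\sum_(i <= j < n.+1) F i j); last by rewrite big_geq_mkord.
  (* Shifting the index by $i$ makes it count the arrows of [pdrop i p]. *)
  rewrite -[X in \big[_/_]_(X <= _ < _) _]add0n big_addn big_mkord.
  rewrite tens_mapU path_comulU plength_pdrop subSn -1?ltnS // linear_sumlz linear_sum.
  by apply: eq_bigr => j _; rewrite /= tensU tens_assocU pdrop_pdrop /F addnK.
rewrite (exchange_big_dep xpredT) //=; apply: eq_bigr => j _.
rewrite tens_mapU path_comulU linear_sumr plength_ptake -1?ltnS //.
transitivity (\sum_(i < j.+1) F i j).
  by rewrite (big_ord_widen n.+1 (F^~ j)).
apply: eq_bigr => i _.
have ij : (i <= j)%N by rewrite -ltnS.
by rewrite /F ptake_pdrop (subnK ij) (ptake_ptake p ij) /= tensU.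
Qed.

Lemma path_coalgebra : is_coalgebra comul counit.
Proof.
split=> [|||x|x].
- exact: lin_ext_is_linear.
- exact: path_counit_scalar.
- exact: path_coassoc.
- move: x; apply: lin_ext_unique => [c u v|c u v|p]; rewrite ?linearP //.
  (* Only the cut after all arrows has a trivial left factor, so the counit keeps that term
     alone. *)
  rewrite path_comulU linear_sum big_ord_recr /= tens_liftU path_counitU.
  rewrite plength_pdrop subnn ptake_plength scale1r big1 ?add0r // => i _.
  by rewrite tens_liftU path_counitU plength_pdrop subn_eq0 leqNgt ltn_ord scale0r.
- move: x; apply: lin_ext_unique => [c u v|c u v|p]; rewrite ?linearP //.
  rewrite path_comulU linear_sum big_ord_recl /= tens_liftU path_counitU.
  rewrite plength_ptake // pdrop0 scale1r big1 ?addr0 // => i _.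
  by rewrite tens_liftU path_counitU plength_ptake // scale0r.
Qed.

End PathCoalgebraAxioms.

(** * The shuffle product of two paths *)

Section PathProduct.
Context {k : fieldType} {Q : quiver} (e : vertex Q).
Notation A := {malg k[path_index Q]}.
Notation AA := {malg k[basis_prod (path_index Q) (path_index Q)]}.
Notation comul := (@path_comul k Q).
Notation counit := (@path_counit k Q).
Implicit Types (g h : vertex Q) (a : arrow Q) (p q r : path_index Q) (x y z : A).

(* The left-zero semigroup with the unit e adjoined.  All that is used is that
   this is a monoid in which g h = e forces g = h = e ([vmul_eq_e]). *)
Definition vmul g h : vertex Q := if `[< g = e >] then h else g.

Lemma vmul_e g : vmul g e = g.
Proof. by rewrite /vmul; case: asboolP. Qed.

Lemma e_vmul g : vmul e g = g.
Proof. by rewrite /vmul asboolT. Qed.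

Lemma vmulA : associative vmul.
Proof.
move=> g h l; rewrite /vmul; case: (asboolP (g = e)) => // ge.
by rewrite asboolF.
Qed.

Lemma vmul_eq_e g h : `[< vmul g h = e >] = `[< g = e >] && `[< h = e >].
Proof. by rewrite /vmul; case: (asboolP (g = e)) => //= ge; rewrite asboolF. Qed.

(** The value [0] on a trivial [p] discards the shuffles that would take an arrow from an exhausted
    path. *)
Definition prepend_head p x : A := if phead p is Some a then prepend a x else 0.

(* n is the total length of p and q.  Since a vertex other than e kills all
   arrows, a shuffle may take an arrow of p only while q stands at e, and an arrow
   of q only while p stands at e. *)
Fixpoint shuffle n p q : A :=
  if n is m.+1 then
    (if `[< psource q = e >] then prepend_head p (shuffle m (ptail p) q) else 0)
    + (if `[< psource p = e >] then prepend_head q (shuffle m p (ptail q)) else 0)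
  else << (trivial_path (vmul (psource p) (psource q)) : path_index Q) >>.

Lemma shuffleS n p q :
  shuffle n.+1 p q =
    (if `[< psource q = e >] then prepend_head p (shuffle n (ptail p) q) else 0)
    + (if `[< psource p = e >] then prepend_head q (shuffle n p (ptail q)) else 0).
Proof. by []. Qed.

Definition path_prod p q : A := shuffle (plength p + plength q) p q.

(** Taking a tail lowers the total length by one when there is an arrow to remove; otherwise the
    fuel does not match, but [prepend_head] makes that term zero. *)
Lemma path_prodS p q : (0 < plength p + plength q)%N ->
  path_prod p q =
    (if `[< psource q = e >] then prepend_head p (path_prod (ptail p) q) else 0)
    + (if `[< psource p = e >] then prepend_head q (path_prod p (ptail q)) else 0).
Proof.
move=> pq0; rewrite {1}/path_prod -(prednK pq0) shuffleS /prepend_head /path_prod.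
have lenp a : phead p = Some a -> (plength (ptail p) + plength q)%N = (plength p + plength q).-1.
  by move/plength_ptail => ->.
have lenq a : phead q = Some a -> (plength p + plength (ptail q))%N = (plength p + plength q).-1.
  by move/plength_ptail => ->; rewrite addnS.
by case pa: (phead p) => [a|]; case qa: (phead q) => [b|];
  rewrite ?(lenp _ pa) ?(lenq _ qa).
Qed.

Lemma path_prod0 p q : plength p = 0%N -> plength q = 0%N ->
  path_prod p q = << (trivial_path (vmul (psource p) (psource q)) : path_index Q) >>.
Proof. by rewrite /path_prod => -> ->. Qed.

End PathProduct.

(* Sealed, because comparing products with basis vectors by unfolding both makes
   unification diverge. *)
HB.lock Definition path_mul (k : fieldType) (Q : quiver) (e : vertex Q)
    (x y : {malg k[path_index Q]}) : {malg k[path_index Q]} :=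
  lin_ext (fun pq => path_prod e pq.1 pq.2) (tens x y).
Arguments path_mul {k Q} e x y.

(** * The product on the path coalgebra and its compatibility with the operators *)

Section PathBialgebra.
Context {k : fieldType} {Q : quiver} (e : vertex Q).
Notation A := {malg k[path_index Q]}.
Notation AA := {malg k[basis_prod (path_index Q) (path_index Q)]}.
Local Notation path_prod := (@path_prod k Q e).
Local Notation path_mul := (@path_mul k Q e).
Notation comul := (@path_comul k Q).
Notation counit := (@path_counit k Q).
Implicit Types (g h : vertex Q) (a : arrow Q) (p q r : path_index Q) (x y z : A) (u v : AA).

Lemma path_mul_bilinear : bilinear_map path_mul.
Proof.
split=> z c u v; rewrite !path_mul.unlock.
  by rewrite [tens _ _](tens_bilinear.1) linearP.
by rewrite [tens _ _](tens_bilinear.2) linearP.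
Qed.

HB.instance Definition _ := bilinear_isBilinear.Build k A A A _ _ path_mul path_mul_bilinear.

Lemma path_mulU p q : path_mul << p >> << q >> = path_prod p q.
Proof. by rewrite path_mul.unlock tensU lin_extU. Qed.

(** If an arrow of [p] comes first in a shuffle, then [q] stands at [e], so the source is that of
    [p], which equals [vmul e (psource p) e]; likewise with the roles exchanged. *)
Lemma start_at_path_prod g p q :
  start_at g (path_prod p q) =
  if `[< vmul e (psource p) (psource q) = g >] then path_prod p q else 0.
Proof.
have [/eqP|pq0] := posnP (plength p + plength q).
  rewrite addn_eq0 => /andP[/eqP p0 /eqP q0].
  by rewrite path_prod0 // start_atU.
have startE r x (b : bool) :
    (forall a, b -> phead r = Some a -> vmul e (psource p) (psource q) = source a) ->
    start_at g (if b then prepend_head r x else 0) =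
    if `[< vmul e (psource p) (psource q) = g >] then if b then prepend_head r x else 0 else 0.
  case: b => [rE|_]; last by rewrite linear0 if_same.
  rewrite /prepend_head; case ra: (phead r) => [a|]; last by rewrite linear0 if_same.
  by rewrite start_at_prepend (rE a).
rewrite path_prodS // linearD /= !startE; first by case: ifP; rewrite ?addr0.
  by move=> a /asboolP -> /phead_source; rewrite e_vmul.
by move=> a /asboolP -> /phead_source; rewrite vmul_e.
Qed.

(** The shuffle recursion chooses the first arrow, so [strip a] undoes one step of it; the condition
    that the other path starts at [e] becomes the factor [start_at e]. *)
Lemma strip_path_prod a p q :
  strip a (path_prod p q) =
  path_mul (strip a << p >>) (start_at e << q >>) + path_mul (start_at e << p >>) (strip a << q >>).
Proof.
have [/eqP|pq0] := posnP (plength p + plength q).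
  rewrite addn_eq0 => /andP[/eqP p0 /eqP q0].
  have strip0 r : plength r = 0%N -> strip a << r >> = 0 :> A.
    by move/eqP; rewrite plength_eq0_phead => /eqP r0; rewrite stripU asboolF ?r0.
  rewrite !strip0 // ?linear0l ?linear0r ?addr0 //.
  by rewrite path_prod0 // stripU asboolF.
rewrite path_prodS // linearD /=; congr (_ + _).
  rewrite stripU start_atU; case: asboolP => qe; last by rewrite linear0r linear0.
  rewrite /prepend_head; case pa: (phead p) => [b|]; last by rewrite asboolF // linear0l linear0.
  rewrite strip_prepend; case: (asboolP (b = a)) => [<-|neq_ba]; last first.
    by rewrite asboolF ?linear0l // => -[].
  (* The projection left by [strip_prepend] acts as the identity: [ptail p] starts at the target of
     [b] and [q] at [e], so all paths in their product start at that target. *)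
  by rewrite asboolT // path_mulU start_at_path_prod (psource_ptail pa) qe vmul_e asboolT.
rewrite stripU start_atU; case: asboolP => pe; last by rewrite linear0l linear0.
rewrite /prepend_head; case qa: (phead q) => [b|]; last by rewrite asboolF // linear0r linear0.
rewrite strip_prepend; case: (asboolP (b = a)) => [<-|neq_ba]; last first.
  by rewrite asboolF ?linear0r // => -[].
by rewrite asboolT // path_mulU start_at_path_prod (psource_ptail qa) pe e_vmul asboolT.
Qed.

Lemma strip_path_mul a x y :
  strip a (path_mul x y) =
  path_mul (strip a x) (start_at e y) + path_mul (start_at e x) (strip a y).
Proof.
move: x y; apply: bilinear_ext => [||p q]; last by rewrite path_mulU strip_path_prod.
  by apply: linear_comp_bilinear; [exact: lin_ext_is_linear | exact: path_mul_bilinear].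
by apply: bilinear_add; apply: bilinear_comp;
  first [exact: lin_ext_is_linear | exact: path_mul_bilinear].
Qed.

(** Here [vmul_eq_e] is used: a product of sources is [e] only if both sources are [e]. *)
Lemma start_at_path_mul x y :
  start_at e (path_mul x y) = path_mul (start_at e x) (start_at e y).
Proof.
move: x y; apply: bilinear_ext => [||p q].
- by apply: linear_comp_bilinear; [exact: lin_ext_is_linear | exact: path_mul_bilinear].
- by apply: bilinear_comp; first [exact: lin_ext_is_linear | exact: path_mul_bilinear].
rewrite path_mulU start_at_path_prod vmul_eq_e !start_atU.
by case: `[< psource p = e >]; case: `[< psource q = e >]; rewrite ?path_mulU ?linear0l ?linear0r.
Qed.

(** If [p] or [q] has an arrow, every path in their product starts with an arrow, so both sides
    vanish. *)
Lemma trivial_part_path_mul x y :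
  trivial_part (path_mul x y) = path_mul (trivial_part x) (trivial_part y).
Proof.
move: x y; apply: bilinear_ext => [||p q].
- by apply: linear_comp_bilinear; [exact: lin_ext_is_linear | exact: path_mul_bilinear].
- by apply: bilinear_comp; first [exact: lin_ext_is_linear | exact: path_mul_bilinear].
rewrite path_mulU !trivial_partU.
have [/eqP|pq0] := posnP (plength p + plength q).
  rewrite addn_eq0 => /andP[/eqP p0 /eqP q0].
  by rewrite p0 q0 path_mulU path_prod0 // trivial_partU.
have trivial0 r x (b : bool) : trivial_part (if b then prepend_head r x else 0) = 0.
  case: b; rewrite ?linear0 // /prepend_head; case: phead => [a|]; rewrite ?linear0 //.
  exact: trivial_part_prepend.
rewrite path_prodS // linearD /= !trivial0 addr0.
move: pq0; rewrite lt0n addn_eq0.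
by case: eqP => _; case: eqP => _ //; rewrite ?linear0l ?linear0r.
Qed.

Lemma path_counit_trivial_part x : counit (trivial_part x) = counit x.
Proof.
move: x; apply: (@lin_ext_unique k _ k^o) => [c u v|c u v|p]; rewrite ?linearP //.
by rewrite trivial_partU; case: ifP => // p0; rewrite linear0 path_counitU p0.
Qed.

(** The counit sees only trivial parts, and it is $1$ on every trivial path. *)
Lemma path_counit_mul x y : counit (path_mul x y) = counit x * counit y.
Proof.
move: x y; apply: (@bilinear_ext k _ _ k^o) => [||p q].
- by split=> z c u v; rewrite (linearPl, linearPr) linearP.
- split=> z c u v; rewrite !linearP /=.
    by rewrite mulrDl -mulrA.
  by rewrite mulrDr mulrCA.
rewrite -path_counit_trivial_part trivial_part_path_mul !trivial_partU !path_counitU.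
case: eqP => p0; last by rewrite linear0l linear0 mul0r.
case: eqP => q0; last by rewrite linear0r linear0 mulr0.
by rewrite path_mulU path_prod0 // path_counitU mulr1.
Qed.

(** * Associativity and unit, by induction on length *)

Lemma start_at_basis g p : start_at g << p >> = << p >> :> A \/ start_at g << p >> = 0 :> A.
Proof. by rewrite start_atU; case: asboolP; [left | right]. Qed.

(** Keeps the inductions among basis vectors; the equation between lengths is what makes them
    descend. *)
Lemma strip_basis a p :
  (exists2 q, plength p = (plength q).+1 & strip a << p >> = << q >> :> A) \/
  strip a << p >> = 0 :> A.
Proof.
rewrite stripU; case: asboolP => [pa|_]; [left | by right].
by exists (ptail p); first exact: plength_ptail pa.
Qed.

Lemma path_mul_trivial g h :
  path_mul << (trivial_path g : path_index Q) >> << (trivial_path h : path_index Q) >> =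
  << (trivial_path (vmul e g h) : path_index Q) >>.
Proof. by rewrite path_mulU path_prod0. Qed.

Lemma plength0_trivial p : plength p = 0%N -> p = trivial_path (psource p).
Proof. by move/size0nil => p0; apply: qpath_eq. Qed.

Lemma trivial_part_basis p :
  (exists g, trivial_part << p >> = << (trivial_path g : path_index Q) >> :> A) \/
  trivial_part << p >> = 0 :> A.
Proof.
rewrite trivial_partU; case: eqP => [/plength0_trivial p0|_]; [left | by right].
by exists (psource p); rewrite -p0.
Qed.

Lemma path_mulA_basis n p q r : (plength p + plength q + plength r < n)%N ->
  path_mul << p >> (path_mul << q >> << r >>) = path_mul (path_mul << p >> << q >>) << r >>.
Proof.
move: p q r; elim: n => [|n IHn] p q r.
  by rewrite ltn0 => /notF[].
move=> len; apply: strip_ext => [a|]; last first.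
  rewrite !trivial_part_path_mul.
  case: (trivial_part_basis p) => [[g ->]|->]; last by rewrite !linear0l.
  case: (trivial_part_basis q) => [[h ->]|->]; last by rewrite !(linear0l, linear0r).
  case: (trivial_part_basis r) => [[l ->]|->]; last by rewrite !linear0r.
  by rewrite !path_mul_trivial vmulA.
(* Each side becomes three products, with [strip a] on one factor and [start_at e] on the other
   two. *)
rewrite !strip_path_mul !start_at_path_mul linearDr linearDl -addrA.
congr (_ + (_ + _)).
- case: (strip_basis a p) => [[p' pE ->]|->]; last by rewrite !linear0l.
  case: (start_at_basis e q) => ->; last by rewrite !(linear0l, linear0r).
  case: (start_at_basis e r) => ->; last by rewrite !linear0r.
  by apply: IHn; move: len; rewrite pE.
- case: (start_at_basis e p) => ->; last by rewrite !linear0l.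
  case: (strip_basis a q) => [[q' qE ->]|->]; last by rewrite !(linear0l, linear0r).
  case: (start_at_basis e r) => ->; last by rewrite !linear0r.
  by apply: IHn; move: len; rewrite qE addnS.
- case: (start_at_basis e p) => ->; last by rewrite !linear0l.
  case: (start_at_basis e q) => ->; last by rewrite !(linear0l, linear0r).
  case: (strip_basis a r) => [[r' rE ->]|->]; last by rewrite !linear0r.
  by apply: IHn; move: len; rewrite rE addnS.
Qed.

Lemma path_mulA : associative path_mul.
Proof.
apply: trilinear_ext => [y z|x z|x y|y z|x z|x y|p q r]; try (move=> c u v /=).
- by rewrite linearPl.
- by rewrite linearPl linearPr.
- by rewrite !linearPr.
- by rewrite !linearPl.
- by rewrite linearPr linearPl.
- by rewrite linearPr.
exact: path_mulA_basis (ltnSn _).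
Qed.

Lemma strip_trivial a g : strip a << (trivial_path g : path_index Q) >> = 0 :> A.
Proof. by rewrite stripU asboolF. Qed.

Lemma path_mul1l : left_id << (trivial_path e : path_index Q) >> path_mul.
Proof.
apply: lin_ext_unique => [c u v|//|p]; first by rewrite linearPr.
have [n] := ubnP (plength p); elim: n p => [|n IHn] p; first by rewrite ltn0 => /notF[].
move=> len; apply: strip_ext => [a|].
  (* The unit is killed by [strip a] and fixed by [start_at e], which leaves one term of the
     derivation rule. *)
  rewrite strip_path_mul strip_trivial linear0l add0r start_atU asboolT //.
  case: (strip_basis a p) => [[q pE ->]|->]; last by rewrite linear0r.
  by apply: IHn; move: len; rewrite pE.
rewrite trivial_part_path_mul trivial_partU /=.
case: (trivial_part_basis p) => [[g ->]|->]; last by rewrite linear0r.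
by rewrite path_mul_trivial e_vmul.
Qed.

Lemma path_mul1r : right_id << (trivial_path e : path_index Q) >> path_mul.
Proof.
apply: lin_ext_unique => [c u v|//|p]; first by rewrite linearPl.
have [n] := ubnP (plength p); elim: n p => [|n IHn] p; first by rewrite ltn0 => /notF[].
move=> len; apply: strip_ext => [a|].
  rewrite strip_path_mul strip_trivial linear0r addr0 start_atU asboolT //.
  case: (strip_basis a p) => [[q pE ->]|->]; last by rewrite linear0l.
  by apply: IHn; move: len; rewrite pE.
rewrite trivial_part_path_mul [in X in path_mul _ X]trivial_partU /=.
case: (trivial_part_basis p) => [[g ->]|->]; last by rewrite linear0l.
by rewrite path_mul_trivial vmul_e.
Qed.

(** * Multiplicativity of the comultiplication *)

Local Notation tmul := (tens_mul path_mul).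

(** On pure tensors the product is taken factorwise, so the derivation rule of the second factor
    carries over. *)
Lemma strip_tens_mul a u v :
  tens_map id (strip a) (tmul u v) =
  tmul (tens_map id (strip a) u) (tens_map id (start_at e) v)
  + tmul (tens_map id (start_at e) u) (tens_map id (strip a) v).
Proof.
move: u v; apply: bilinear_ext => [||[p p'] [q q']].
- by apply: linear_comp_bilinear; [exact: tens_lift_linear | exact: tens_mul_bilinear].
- by apply: bilinear_add; apply: bilinear_comp;
    first [exact: tens_lift_linear | exact: tens_mul_bilinear].
rewrite -(tensU p p') -(tensU q q').
apply: etrans (tens_map_id_mulE path_mul_bilinear _ _ _ _ _) _.
rewrite /= strip_path_mul linearDr.
by congr (_ + _); apply/esym/tens_mul_map_idE/path_mul_bilinear.
Qed.

Lemma trivial_part_tens_mul u v :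
  tens_map id trivial_part (tmul u v) =
  tmul (tens_map id trivial_part u) (tens_map id trivial_part v).
Proof.
move: u v; apply: bilinear_ext => [||[p p'] [q q']].
- by apply: linear_comp_bilinear; [exact: tens_lift_linear | exact: tens_mul_bilinear].
- by apply: bilinear_comp; first [exact: tens_lift_linear | exact: tens_mul_bilinear].
rewrite -(tensU p p') -(tensU q q').
apply: etrans (tens_map_id_mulE path_mul_bilinear _ _ _ _ _) _.
by rewrite /= trivial_part_path_mul; apply/esym/tens_mul_map_idE/path_mul_bilinear.
Qed.

Lemma start_at_psource p : start_at (psource p) << p >> = << p >> :> A.
Proof. by rewrite start_atU asboolT. Qed.

Lemma path_comul_mulU p q :
  comul (path_mul << p >> << q >>) = tmul (comul << p >>) (comul << q >>).
Proof.
have [n] := ubnP (plength p + plength q); elim: n p q => [|n IHn] p q.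
  by rewrite ltn0 => /notF[].
move=> len; apply: strip_ext_tens => [a|].
  (* Both operators pass through the comultiplication, which leaves the same identity for shorter
     pairs of paths. *)
  rewrite strip_comul strip_path_mul linearD strip_tens_mul !strip_comul !start_at_comul.
  congr (_ + _).
    case: (strip_basis a p) => [[p' pE ->]|->]; last by rewrite !(linear0l, linear0).
    case: (start_at_basis e q) => ->; last by rewrite !(linear0r, linear0).
    by apply: IHn; move: len; rewrite pE.
  case: (start_at_basis e p) => ->; last by rewrite !(linear0l, linear0).
  case: (strip_basis a q) => [[q' qE ->]|->]; last by rewrite !(linear0r, linear0).
  by apply: IHn; move: len; rewrite qE addnS.
(* All paths in the product share one source, so [trivial_part_comul_start_at] applies and both
   sides become $pq\otimes s(p)s(q)$. *)
have pqE : path_mul << p >> << q >> =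
    start_at (vmul e (psource p) (psource q)) (path_mul << p >> << q >>).
  by rewrite path_mulU start_at_path_prod asboolT.
rewrite trivial_part_tens_mul pqE trivial_part_comul_start_at -pqE.
rewrite -(start_at_psource p) -(start_at_psource q) !trivial_part_comul_start_at.
rewrite tens_mulE ?path_mul_trivial //; exact: path_mul_bilinear.
Qed.

Lemma path_comul_mul x y : comul (path_mul x y) = tmul (comul x) (comul y).
Proof.
move: x y; apply: bilinear_ext => [||p q]; last exact: path_comul_mulU.
- by apply: linear_comp_bilinear; [exact: lin_ext_is_linear | exact: path_mul_bilinear].
- by apply: bilinear_comp; first [exact: lin_ext_is_linear | exact: tens_mul_bilinear].
Qed.

Lemma path_bialgebra :
  is_bialgebra path_mul << (trivial_path e : path_index Q) >> comul counit.
Proof.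
split.
- split; [exact: path_mul_bilinear | exact: path_mulA | exact: path_mul1l | exact: path_mul1r].
- exact: path_coalgebra.
- exact: path_comul_mul.
- by rewrite path_comulU big_ord1 tensU pdrop0 ptake0.
- exact: path_counit_mul.
- by rewrite path_counitU.
Qed.

End PathBialgebra.

Theorem theorem3p2 (k : fieldType) (Q : quiver) (Q0_nonempty : inhabited (vertex Q)) :
  exists (mul : {malg k[path_index Q]} -> {malg k[path_index Q]} -> {malg k[path_index Q]})
         (one : {malg k[path_index Q]}),
    is_bialgebra mul one (@path_comul k Q) (@path_counit k Q).
(* Any vertex can serve as [e]; the unit is its trivial path. *)
Proof. by case: Q0_nonempty => e; do 2!eexists; apply: (path_bialgebra e). Qed.
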